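(* Let $\mathbf U=\langle\langle U,\approx\rangle,\preceq\rangle$ be a completely lattice $\mathbf L$-ordered set. The system of all complete binary $\mathbf L$-relations on $\mathbf U$ is an $\mathbf L$-closure system in the set $U\times U$, and hence (with the restrictions of $\approx^{U\times U}$ and $S$) a completely lattice $\mathbf L$-ordered set.
   Context: $\mathbf L=\langle L,\wedge,\vee,\otimes,\to,0,1\rangle$ is a complete residuated lattice ($\langle L,\wedge,\vee,0,1\rangle$ complete lattice, $\langle L,\otimes,1\rangle$ commutative monoid, $a\otimes b\le c$ iff $a\le b\to c$). An $\mathbf L$-set in $X$ is a map $X\to L$; $L^X$ the set of them; $S(A,B)=\bigwedge_x(A(x)\to B(x))$, $A\approx^X B=S(A,B)\wedge S(B,A)$. An $\mathbf L$-equality is a binary $\mathbf L$-relation that is reflexive, symmetric, transitive ($R(x,y)\otimes R(y,z)\le R(x,z)$) and with $R(x,y)=1\Rightarrow x=y$. An $\mathbf L$-ordered set is $\langle\langle U,\approx\rangle,\preceq\rangle$, $\approx$ an $\mathbf L$-equality, $\preceq$ reflexive, transitive, compatible with $\approx$ ($(u\preceq v)\otimes(u\approx u')\otimes(v\approx v')\le(u'\preceq v')$), and $(u\preceq v)\wedge(v\preceq u)\le u\approx v$. For $V\in L^U$: $\mathcal L V(v)=\bigwedge_u(V(u)\to(v\preceq u))$, $\mathcal U V(v)=\bigwedge_u(V(u)\to(u\preceq v))$; $\inf V$ is the unique $u$ with $\mathcal L V(u)=1=\mathcal U(\mathcal L V)(u)$, $\sup V$ the unique $u$ with $\mathcal U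 V(u)=1=\mathcal L(\mathcal U V)(u)$; completely lattice means these exist for all $V$. For a set $X$, $\langle\langle L^X,\approx^X\rangle,S\rangle$ is a completely lattice $\mathbf L$-ordered set with $(\inf \mathcal V)(x)=\bigwedge_{W\in L^X}(\mathcal V(W)\to W(x))$ for $\mathcal V\in L^{L^X}$; an $\mathbf L$-closure system in $X$ is a subset $M\subseteq L^X$ such that $\inf\mathcal V\in M$ for every $\mathbf L$-set $\mathcal V$ in $L^X$ with $\mathcal V(W)=0$ for $W\notin M$. Power relation: for $R$ on $X$ and $A,B\in L^X$, $(R\circ B)(x)=\bigvee_y R(x,y)\otimes B(y)$, $(A\circ R)(y)=\bigvee_x A(x)\otimes R(x,y)$, $R^+(A,B)=S(A,R\circ B)\wedge S(B,A\circ R)$. A binary $\mathbf L$-relation $R$ on $\mathbf U$ is complete if it is compatible with $\approx$ (i.e. $R(u,v)\otimes(u\approx u')\otimes(v\approx v')\le R(u',v')$) and for all $V_1,V_2\in L^U$, $R^+(V_1,V_2)\le R(\inf V_1,\inf V_2)$ and $R^+(V_1,V_2)\le R(\sup V_1,\sup V_2)$. *)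

(* Defs.v *)
From HB Require Import structures.
From mathcomp Require Import all_boot all_order.
From mathcomp Require Import boolp classical_sets.

Set Implicit Arguments.
Unset Strict Implicit.
Unset Printing Implicit Defensive.

Import Order.TTheory.
Local Open Scope order_scope.

(* Completeness is required of arbitrary subsets, hence the operations on
   [set L]; the unit of the monoid is the top element of the lattice.  The case
   \bot = \top is not excluded. *)
HB.mixin Record isCompleteResiduated d (L : Type) of Order.TBLattice d L := {
  bigmeet : set L -> L;
  bigjoin : set L -> L;
  bigmeetP : forall A : set L, infimums A (bigmeet A);
  bigjoinP : forall A : set L, supremums A (bigjoin A);
  otimes : L -> L -> L;
  resid : L -> L -> L;
  otimesA : associative otimes;
  otimesC : commutative otimes;
  otimes1x : left_id \top otimes;
  residP : forall a b c : L, (otimes a b <= c) = (a <= resid b c)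
}.

#[short(type="completeResiduatedLatticeType")]
HB.structure Definition CompleteResiduatedLattice d :=
  {L of Order.TBLattice d L & isCompleteResiduated d L}.

Notation "a ⊗ b" := (otimes a b) (at level 40, left associativity).
Notation "a ⇒ b" := (resid a b) (at level 55, right associativity).
Notation "⋀ x , F" := (bigmeet (range (fun x => F)))
  (at level 60, x binder, F at level 60, right associativity).
Notation "⋁ x , F" := (bigjoin (range (fun x => F)))
  (at level 60, x binder, F at level 60, right associativity).

Section LSets.
Context {d : Order.disp_t} (L : completeResiduatedLatticeType d).

Definition lset (X : Type) : Type := X -> L.

(* A binary L-relation on X is an L-set in X * X. *)
Definition lrel (X : Type) : Type := lset (X * X).

Definition subsethood (X : Type) : lrel (lset X) :=
  fun p => ⋀ x, (p.1 x ⇒ p.2 x).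

Definition lset_eq (X : Type) : lrel (lset X) :=
  fun p => subsethood (p.1, p.2) `&` subsethood (p.2, p.1).

End LSets.

Arguments subsethood {d L X}.
Arguments lset_eq {d L X}.

Section LOrder.
Context {d : Order.disp_t} {L : completeResiduatedLatticeType d} {U : Type}.
Implicit Types (R e le : lrel L U) (V : lset L U).

Definition lrel_reflexive R : Prop := forall u, R (u, u) = \top.

Definition lrel_symmetric R : Prop := forall u v, R (u, v) = R (v, u).

Definition lrel_transitive R : Prop :=
  forall u v w, R (u, v) ⊗ R (v, w) <= R (u, w).

Definition compatible e R : Prop :=
  forall u v u' v', R (u, v) ⊗ e (u, u') ⊗ e (v, v') <= R (u', v').

Definition is_lequality e : Prop :=
  [/\ lrel_reflexive e, lrel_symmetric e, lrel_transitive e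
    & forall u v, e (u, v) = \top -> u = v].

Definition is_lordered e le : Prop :=
  [/\ is_lequality e, lrel_reflexive le, lrel_transitive le, compatible e le
    & forall u v, le (u, v) `&` le (v, u) <= e (u, v)].

Definition lower_cone le V : lset L U := fun v => ⋀ u, (V u ⇒ le (v, u)).

Definition upper_cone le V : lset L U := fun v => ⋀ u, (V u ⇒ le (u, v)).

Definition is_linf le V (u : U) : Prop :=
  lower_cone le V u = \top /\ upper_cone le (lower_cone le V) u = \top.

Definition is_lsup le V (u : U) : Prop :=
  upper_cone le V u = \top /\ lower_cone le (upper_cone le V) u = \top.

Definition completely_lattice e le : Prop :=
  is_lordered e le /\
  forall V, (exists! u, is_linf le V u) /\ (exists! u, is_lsup le V u).

Definition linf e le (h : completely_lattice e le) V : U :=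
  sval (cid (h.2 V).1).

Definition lsup e le (h : completely_lattice e le) V : U :=
  sval (cid (h.2 V).2).

Definition lpostimage R V : lset L U := fun x => ⋁ y, (R (x, y) ⊗ V y).

Definition lpreimage V R : lset L U := fun y => ⋁ x, (V x ⊗ R (x, y)).

Definition power_rel R : lrel L (lset L U) :=
  fun p => subsethood (p.1, lpostimage R p.2)
           `&` subsethood (p.2, lpreimage p.1 R).

Definition complete_lrel e le (h : completely_lattice e le) R : Prop :=
  [/\ compatible e R,
      forall V1 V2, power_rel R (V1, V2) <= R (linf h V1, linf h V2)
    & forall V1 V2, power_rel R (V1, V2) <= R (lsup h V1, lsup h V2)].

Definition complete_lrels e le (h : completely_lattice e le) :
  set (lrel L U) := [set R | complete_lrel h R]%classic.

Definition lrel_restrict (M : set U) R : lrel L (set_type M) :=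
  fun p => R (val p.1, val p.2).

End LOrder.

Arguments lrel_restrict {d L U} M R.

Section LSetLattice.
Context {d : Order.disp_t} {L : completeResiduatedLatticeType d}.
Implicit Types (a b c : L).

Lemma le_imeet (I : Type) (F : I -> L) c :
  (forall i, c <= F i) -> c <= ⋀ i, F i.
Proof. by move=> h; apply: (bigmeetP _).2 => _ [i _ <-]. Qed.

Lemma imeet_le (I : Type) (F : I -> L) i : (⋀ i, F i) <= F i.
Proof. by apply: (bigmeetP _).1; exists i. Qed.

Lemma ijoin_le (I : Type) (F : I -> L) c :
  (forall i, F i <= c) -> (⋁ i, F i) <= c.
Proof. by move=> h; apply: (bigjoinP _).2 => _ [i _ <-]. Qed.

Lemma le_ijoin (I : Type) (F : I -> L) i : F i <= ⋁ i, F i.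
Proof. by apply: (bigjoinP _).1; exists i. Qed.

Lemma otimesx1 a : a ⊗ \top = a.
Proof. by rewrite otimesC otimes1x. Qed.

Lemma resid_mp a b : (a ⇒ b) ⊗ a <= b.
Proof. by rewrite residP. Qed.

Lemma otimes_le2l a b c : a <= b -> a ⊗ c <= b ⊗ c.
Proof. by move=> ab; rewrite residP (le_trans ab)// -residP. Qed.

Lemma otimes_le2r a b c : a <= b -> c ⊗ a <= c ⊗ b.
Proof. by move=> ab; rewrite ![c ⊗ _]otimesC otimes_le2l. Qed.

Lemma otimes_le2 a b c c' : a <= b -> c <= c' -> a ⊗ c <= b ⊗ c'.
Proof.
by move=> ab cc; exact: le_trans (otimes_le2l _ ab) (otimes_le2r _ cc).
Qed.

Lemma resid_eq1 a b : (a ⇒ b = \top) <-> a <= b.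
Proof.
rewrite -{2}[a]otimes1x residP; split => [->//|h].
by apply/eqP; rewrite eq_le lex1.
Qed.

Lemma imeet_eq1 (I : Type) (F : I -> L) :
  ((⋀ i, F i) = \top) <-> forall i, F i = \top.
Proof.
split=> [h i|h]; apply/eqP; rewrite eq_le lex1/=.
  by rewrite -h; exact: imeet_le.
by apply: le_imeet => i; rewrite h.
Qed.

Section GenericInf.
Context {U : Type} (e le : lrel L U).

Lemma is_linf_unique V u v :
  is_lordered e le -> is_linf le V u -> is_linf le V v -> u = v.
Proof.
case=> -[_ _ _ e1] _ _ _ anti [lu uu] [lv uv]; apply: e1.
apply/eqP; rewrite eq_le lex1/= (le_trans _ (anti _ _))// lexI.
move/imeet_eq1/(_ u)/resid_eq1: uv; rewrite lu => ->.
by move/imeet_eq1/(_ v)/resid_eq1: uu; rewrite lv => ->.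
Qed.

Lemma is_lsup_unique V u v :
  is_lordered e le -> is_lsup le V u -> is_lsup le V v -> u = v.
Proof.
case=> -[_ _ _ e1] _ _ _ anti [uu lu] [uv lv]; apply: e1.
apply/eqP; rewrite eq_le lex1/= (le_trans _ (anti _ _))// lexI.
move/imeet_eq1/(_ v)/resid_eq1: lu; rewrite uv => ->.
by move/imeet_eq1/(_ u)/resid_eq1: lv; rewrite uu => ->.
Qed.

Lemma linfP (h : completely_lattice e le) V : is_linf le V (linf h V).
Proof. by rewrite /linf; case: cid => u /= []. Qed.

Lemma lsupP (h : completely_lattice e le) V : is_lsup le V (lsup h V).
Proof. by rewrite /lsup; case: cid => u /= []. Qed.

End GenericInf.

Context (X : Type).
Implicit Types (A B C : lset L X) (W : lset L (lset L X)).

Lemma subsethood_mp A B x : subsethood (A, B) ⊗ A x <= B x.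
Proof. by rewrite residP; exact: (imeet_le (fun x => A x ⇒ B x)). Qed.

Lemma le_subsethood c A B :
  (forall x, c ⊗ A x <= B x) -> c <= subsethood (A, B).
Proof. by move=> h; apply: le_imeet => x /=; rewrite -residP. Qed.

Lemma subsethood_eq1 A B : (subsethood (A, B) = \top) <-> forall x, A x <= B x.
Proof.
by split=> [/imeet_eq1 h x|h]; [|apply/imeet_eq1 => x /=]; apply/resid_eq1.
Qed.

Lemma subsethood_refl : lrel_reflexive (@subsethood _ L X).
Proof. by move=> A; apply/subsethood_eq1. Qed.

Lemma subsethood_trans : lrel_transitive (@subsethood _ L X).
Proof.
move=> A B C; apply: le_subsethood => x.
rewrite [subsethood (A, B) ⊗ _]otimesC -otimesA.
exact: le_trans (otimes_le2r _ (subsethood_mp _ _ _)) (subsethood_mp _ _ _).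
Qed.

Lemma lset_is_lordered : is_lordered (@lset_eq _ L X) subsethood.
Proof.
split=> //; [split| exact: subsethood_refl | exact: subsethood_trans | ].
- by move=> A; rewrite /lset_eq/= subsethood_refl meetxx.
- by move=> A B; rewrite /lset_eq/= meetC.
- move=> A B C; rewrite lexI; apply/andP; split => /=.
    apply: le_trans (subsethood_trans A B C).
    by apply: otimes_le2; rewrite leIl.
  apply: le_trans (subsethood_trans C B A); rewrite otimesC.
  by apply: otimes_le2; rewrite leIr.
- move=> A B /eqP; rewrite /lset_eq/= meet_eq1 => /andP[/eqP/subsethood_eq1 AB].
  move=> /eqP/subsethood_eq1 BA; apply/funext => x.
  by apply/eqP; rewrite eq_le AB BA.
- move=> A B A' B'; rewrite [subsethood (A, B) ⊗ _]otimesC.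
  apply: le_trans (subsethood_trans A' B B').
  apply: otimes_le2; last by rewrite leIl.
  apply: le_trans (subsethood_trans A' A B).
  by apply: otimes_le2 => //; rewrite leIr.
Qed.

Definition lset_inf W : lset L X := fun x => ⋀ A : lset L X, (W A ⇒ A x).

Definition lset_sup W : lset L X := fun x => ⋁ A : lset L X, (W A ⊗ A x).

Lemma lset_infP W : is_linf subsethood W (lset_inf W).
Proof.
split; apply/imeet_eq1 => A; apply/resid_eq1; apply: le_subsethood => x.
  by rewrite otimesC -[X in _ <= X]/(A x) residP; exact: imeet_le.
apply: le_imeet => B; rewrite -residP -otimesA [A x ⊗ _]otimesC otimesA.
apply: le_trans (subsethood_mp A B x); apply: otimes_le2l.
by rewrite residP; exact: imeet_le.
Qed.

Lemma lset_supP W : is_lsup subsethood W (lset_sup W).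
Proof.
split; apply/imeet_eq1 => A; apply/resid_eq1; apply: le_subsethood => x.
  exact: (le_ijoin (fun A : lset L X => W A ⊗ A x)).
rewrite otimesC residP; apply: ijoin_le => B; rewrite -residP.
rewrite otimesC otimesA; apply: le_trans (subsethood_mp B A x).
by apply: otimes_le2l; rewrite residP; exact: imeet_le.
Qed.

Lemma lset_completely_lattice : completely_lattice (@lset_eq _ L X) subsethood.
Proof.
have ord := lset_is_lordered.
split=> // W; split.
  exists (lset_inf W); split=> [|A]; first exact: lset_infP.
  exact: (is_linf_unique ord (lset_infP W)).
exists (lset_sup W); split=> [|A]; first exact: lset_supP.
exact: (is_lsup_unique ord (lset_supP W)).
Qed.

Lemma linf_lsetE W : linf lset_completely_lattice W = lset_inf W.
Proof.
exact: (is_linf_unique lset_is_lordered (linfP _ W) (lset_infP W)).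
Qed.

Definition is_lclosure_system (M : set (lset L X)) : Prop :=
  forall W, (forall A, ~ M A -> W A = \bot) ->
    M (linf lset_completely_lattice W).

End LSetLattice.

(* Main.v *)
Require Import Defs.
From HB Require Import structures.
From mathcomp Require Import all_boot all_order.
From mathcomp Require Import boolp classical_sets.

(** Let [R] be the infimum of an L-set [W] of complete relations.  For each [A]
    the degree [W A] is at most [S(R, A)], and the power relation is monotone in
    the graded sense [R^+ ⊗ S(R, A) <= A^+]; hence every defining inequality of
    completeness passes from the members of [W] to [R].  An L-closure system
    [M] inherits infima, by extending L-sets in [M] by 0, and therefore also
    suprema, because the supremum of [V] is the infimum of its upper cone. *)

Import Order.TTheory.
Local Open Scope order_scope.

Section ClosureSystems.
Context {d : Order.disp_t} {L : completeResiduatedLatticeType d}.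
Implicit Types a b c : L.

Lemma otimes0x a : \bot ⊗ a = \bot.
Proof. by apply/eqP; rewrite eq_le le0x andbT residP le0x. Qed.

Lemma otimesx0 a : a ⊗ \bot = \bot.
Proof. by rewrite otimesC otimes0x. Qed.

(** Every degree [V v] is at most the degree of [v] in the lower cone of the upper cone of [V], and
    the latter is at most [le (v, u)] because [u] is an infimum of the upper cone. *)
Lemma is_lsup_linf_upper_cone {U : Type} (le : lrel L U) (V : lset L U) u :
  is_linf le (upper_cone le V) u -> is_lsup le V u.
Proof.
case=> lu uu; split=> //; apply/imeet_eq1 => v; apply/resid_eq1.
move/imeet_eq1/(_ v)/resid_eq1: uu; apply: le_trans.
apply: le_imeet => w; rewrite -residP otimesC residP.
exact: (imeet_le (fun v => V v ⇒ le (v, w))).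
Qed.

Lemma completely_lattice_linf {U : Type} (e le : lrel L U) :
  is_lordered e le -> (forall V, exists u, is_linf le V u) ->
  completely_lattice e le.
Proof.
move=> ord hinf; split=> // V; split.
  have [u hu] := hinf V; exists u; split=> // v.
  exact: (is_linf_unique ord).
have [u hu] := hinf (upper_cone le V).
have su := is_lsup_linf_upper_cone _ _ _ hu.
by exists u; split=> // v; exact: (is_lsup_unique ord).
Qed.

Lemma lrel_restrict_is_lordered {U : Type} (M : set U) (e le : lrel L U) :
  is_lordered e le -> is_lordered (lrel_restrict M e) (lrel_restrict M le).
Proof.
case=> -[er es et e1] lr lt lc la; split; first split.
- by move=> u; exact: er.
- by move=> u v; exact: es.
- by move=> u v w; exact: et.
- by move=> u v /e1/val_inj.
- by move=> u; exact: lr.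
- by move=> u v w; exact: lt.
- by move=> u v u' v'; exact: lc.
- by move=> u v; exact: la.
Qed.

Definition extend0 {X : Type} {M : set X} (V : lset L (set_type M)) : lset L X :=
  fun x => oapp V \bot (insub x).

Lemma extend0_val {X : Type} {M : set X} (V : lset L (set_type M)) x :
  extend0 V (val x) = V x.
Proof. by rewrite /extend0 valK. Qed.

Lemma extend0_notin {X : Type} {M : set X} (V : lset L (set_type M)) x :
  ~ M x -> extend0 V x = \bot.
Proof. by move=> nMx; rewrite /extend0 insubF//; apply: memNset. Qed.

(** Outside [M] the extension is [\bot], and a residuum with premise [\bot] is [\top], so the
    additional terms of the meet impose no constraint. *)
Lemma lower_cone_restrict {X : Type} {M : set X} (le : lrel L X)
    (V : lset L (set_type M)) x :
  lower_cone (lrel_restrict M le) V x <= lower_cone le (extend0 V) (val x).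
Proof.
apply: le_imeet => y; rewrite /extend0; case: insubP => [z _ <-|_] /=.
  exact: (imeet_le (fun z => V z ⇒ lrel_restrict M le (x, z))).
by rewrite -residP otimesx0 le0x.
Qed.

Lemma lclosure_system_completely_lattice {X : Type} (M : set (lset L X)) :
  is_lclosure_system M ->
  completely_lattice (lrel_restrict M lset_eq) (lrel_restrict M subsethood).
Proof.
move=> Mcl; apply: completely_lattice_linf.
  exact/lrel_restrict_is_lordered/lset_is_lordered.
move=> V; have := Mcl (extend0 V) (extend0_notin V).
(* The infimum of the extended L-set in the ambient lattice lies in [M], so it can serve as the
   infimum within [M]. *)
rewrite linf_lsetE => /mem_set MI; exists (exist (fun A => A \in M) _ MI).
have [lI uI] := lset_infP (extend0 V).
split; apply/imeet_eq1 => B; apply/resid_eq1.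
  by rewrite -extend0_val; move/imeet_eq1/(_ (val B))/resid_eq1: lI.
apply: le_trans (lower_cone_restrict _ _ _) _.
by move/imeet_eq1/(_ (val B))/resid_eq1: uI.
Qed.

End ClosureSystems.

Section PowerRelation.
Context {d : Order.disp_t} {L : completeResiduatedLatticeType d} {U : Type}.
Implicit Types (R A : lrel L U) (V : lset L U).

(** The join is bounded term by term: in each term the factor [R (x, y)] absorbs [subsethood (R, A)]
    and becomes [A (x, y)]. *)
Lemma lpostimage_subsethood R A V x :
  lpostimage R V x ⊗ subsethood (R, A) <= lpostimage A V x.
Proof.
rewrite residP; apply: ijoin_le => y; rewrite -residP otimesC otimesA.
apply: le_trans (le_ijoin (fun y => A (x, y) ⊗ V y) y).
by apply: otimes_le2l; exact: subsethood_mp.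
Qed.

Lemma lpreimage_subsethood R A V y :
  lpreimage V R y ⊗ subsethood (R, A) <= lpreimage V A y.
Proof.
rewrite residP; apply: ijoin_le => x; rewrite -residP -otimesA.
apply: le_trans (le_ijoin (fun x => V x ⊗ A (x, y)) x).
by apply: otimes_le2r; rewrite otimesC; exact: subsethood_mp.
Qed.

Lemma power_rel_subsethood R A V1 V2 :
  power_rel R (V1, V2) ⊗ subsethood (R, A) <= power_rel A (V1, V2).
Proof.
rewrite lexI; apply/andP; split.
  apply: le_trans (otimes_le2l _ (leIl _ _)) _; apply: le_subsethood => x.
  (* Bringing [V1 x] next to the first subsethood degree turns their product into the post-image
     under [R], which the remaining factor carries to [A]. *)
  rewrite -otimesA [_ ⊗ V1 x]otimesC otimesA.
  apply: le_trans (lpostimage_subsethood R A V2 x).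
  by apply: otimes_le2l; exact: subsethood_mp.
apply: le_trans (otimes_le2l _ (leIr _ _)) _; apply: le_subsethood => x.
rewrite -otimesA [_ ⊗ V2 x]otimesC otimesA.
apply: le_trans (lpreimage_subsethood R A V1 x).
by apply: otimes_le2l; exact: subsethood_mp.
Qed.

End PowerRelation.

Lemma complete_lrels_lclosure (d : Order.disp_t)
    (L : completeResiduatedLatticeType d) (U : Type) (e le : lrel L U)
    (h : completely_lattice e le) : is_lclosure_system (complete_lrels h).
Proof.
move=> W W0; rewrite linf_lsetE.
set R := lset_inf W.
have WS A : W A <= subsethood (R, A).
  by have [/imeet_eq1/(_ A)/resid_eq1] := lset_infP W.
(* Only complete [A] need testing: the others have [W A = \bot], and for complete [A] the weight
   [W A] is replaced by the larger [subsethood (R, A)]. *)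
have le_inf c p :
    (forall A, complete_lrel h A -> c ⊗ subsethood (R, A) <= A p) -> c <= R p.
  move=> hc; apply: le_imeet => A; rewrite -residP.
  have [cA|/W0 ->] := pselect (complete_lrel h A); last first.
    by rewrite otimesx0 le0x.
  exact: le_trans (otimes_le2r _ (WS A)) (hc A cA).
split=> [u v u' v'|V1 V2|V1 V2]; apply: le_inf => A [Ac Ai As].
- apply: le_trans (Ac u v u' v').
  (* Moving [subsethood (R, A)] to the front lets it act on [R (u, v)] while the two equality
     degrees stay fixed. *)
  rewrite otimesC !otimesA; do 2 apply: otimes_le2l.
  exact: subsethood_mp.
- exact: le_trans (power_rel_subsethood _ _ _ _) (Ai V1 V2).
- exact: le_trans (power_rel_subsethood _ _ _ _) (As V1 V2).
Qed.

Theorem theorem8 (d : Order.disp_t) (L : completeResiduatedLatticeType d)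
    (U : Type) (e le : lrel L U) (h : completely_lattice e le) :
  is_lclosure_system (complete_lrels h) /\
  completely_lattice (lrel_restrict (complete_lrels h) lset_eq)
                     (lrel_restrict (complete_lrels h) subsethood).
Proof.
have Mcl := complete_lrels_lclosure _ _ _ _ _ h.
by split=> //; exact: lclosure_system_completely_lattice.
Qed.
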